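(* The word problem for any finitely presented commutative dialgebra is algorithmically solvable. That is, for any finite set $X$ and any finite subset $S\subseteq Di[X]$, there is an algorithm which, given $f\in Di[X]$, decides whether $f=0$ in $Di[X|S]=Di[X]/Id(S)$, i.e. whether $f\in Id(S)$.
   Context: Fix a field $\mathbf{k}$ (algorithms are understood to treat field operations and equality tests in $\mathbf{k}$ as elementary steps). A commutative dialgebra is a $\mathbf{k}$-linear space with two bilinear operations $\vdash,\dashv$, each associative and commutative, satisfying $a\dashv(b\vdash c)=a\dashv(b\dashv c)$, $(a\dashv b)\vdash c=(a\vdash b)\vdash c$, $a\vdash(b\dashv c)=(a\vdash b)\dashv c$. An ideal is a subspace closed under multiplication (by $\vdash$ and by $\dashv$) with arbitrary elements; $Id(S)$ is the ideal generated by $S$. Let $X$ be a totally ordered set and $\lfloor X^+\rfloor$ the free commutative semigroup without unit on $X$ (elements $\lfloor u\rfloor$, length $|u|$). Let $\lfloor X^+\rfloor_1=\{\lfloor u\rfloor_1\mid\lfloor u\rfloor\in\lfloor X^+\rfloor\}$ and $\lfloor XX\rfloor_2=\{\lfloor v\rfloor_2\mid\lfloor v\rfloor\in\lfloor X^+\rfloor,|v|=2\}$ (formal symbols); $x\in X$ is identified with $\lfloor x\rfloor_1$. $Di[X]$ is the free commutative dialgebra generated by $X$: the $\mathbf{k}$-space with basis $\lfloor X^+\rfloor_1\cup\lfloor XX\rfloor_2$ and operations: for $x,x'\in X$, $x\dashv x'=\lfloor xx'\rfloor_1$, $x\vdash x'=\lfloor xx'\rfloor_2$; and if $|uv|>2$,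 $\lfloor u\rfloor_p\vdash\lfloor v\rfloor_q=\lfloor u\rfloor_p\dashv\lfloor v\rfloor_q=\lfloor uv\rfloor_1$. A finitely presented commutative dialgebra is one of the form $Di[X]/Id(S)$ with $X$ and $S$ finite. *)

(* Defs.v *)
From HB Require Import structures.
From mathcomp Require Import all_boot all_order all_algebra.
From mathcomp Require Import finmap.
From mathcomp Require Import monalg.

Set Implicit Arguments.
Unset Strict Implicit.
Unset Printing Implicit Defensive.

Import GRing.Theory.
Local Open Scope ring_scope.

(** ** Commutative dialgebras and their ideals *)

HB.mixin Record isCommDialgebra (k : fieldType) V of GRing.Lmodule k V := {
  vdash : V -> V -> V;
  dashv : V -> V -> V;
  vdash_linearl : forall w, linear (vdash^~ w);
  vdash_linearr : forall u, linear (vdash u);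
  dashv_linearl : forall w, linear (dashv^~ w);
  dashv_linearr : forall u, linear (dashv u);
  vdashA : associative vdash;
  dashvA : associative dashv;
  vdashC : commutative vdash;
  dashvC : commutative dashv;
  dashv_vdash : forall a b c, dashv a (vdash b c) = dashv a (dashv b c);
  vdash_dashv : forall a b c, vdash (dashv a b) c = vdash (vdash a b) c;
  vdash_dashvA : forall a b c, vdash a (dashv b c) = dashv (vdash a b) c
}.

#[short(type="commDialgType")]
HB.structure Definition CommDialgebra (k : fieldType) :=
  { V of isCommDialgebra k V & GRing.Lmodule k V }.

Section Ideals.
Context (k : fieldType) (V : commDialgType k).

Record is_ideal (I : V -> Prop) : Prop := IsIdeal {
  ideal0 : I 0;
  idealD : forall f g, I f -> I g -> I (f + g);
  idealZ : forall (c : k) f, I f -> I (c *: f);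
  ideal_vdashl : forall a f, I f -> I (vdash a f);
  ideal_vdashr : forall a f, I f -> I (vdash f a);
  ideal_dashvl : forall a f, I f -> I (dashv a f);
  ideal_dashvr : forall a f, I f -> I (dashv f a)
}.

Definition Id (S : {pred V}) (f : V) : Prop :=
  forall I : V -> Prop, is_ideal I -> (forall s, s \in S -> I s) -> I f.
End Ideals.

(** ** The free commutative dialgebra *)

Section Words.
Context (X : choiceType).

Definition word := {u : {cmonom X} | u != mone}.
Definition word2 := {v : {cmonom X} | mdeg v == 2%N}.

(* [inl u] stands for u with index 1, [inr v] for v with index 2. *)
Definition diword := (word + word2)%type.
HB.instance Definition _ := Choice.on diword.

Definition diword_val (a : diword) : {cmonom X} :=
  match a with inl u => val u | inr v => val v end.

Lemma diword_val_neq1 a : diword_val a != mone.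
Proof.
case: a => [[u //]|[v /= /eqP dv]].
by rewrite -mdeg_eq0 dv.
Qed.

Lemma diword_mul_neq1 a b : mmul (diword_val a) (diword_val b) != mone.
Proof. by rewrite cmM_eq1 negb_and diword_val_neq1. Qed.

Definition word_dashv (a b : diword) : diword :=
  inl (exist _ (mmul (diword_val a) (diword_val b)) (diword_mul_neq1 a b)).

(* Words are nonempty, so |uv| = 2 exactly when u and v are both letters. *)
Definition word_vdash (a b : diword) : diword :=
  if insub (mmul (diword_val a) (diword_val b)) is Some v
  then inr v else word_dashv a b.

Lemma word_dashv_val a b :
  diword_val (word_dashv a b) = mmul (diword_val a) (diword_val b).
Proof. by []. Qed.

Lemma word_vdash_val a b :
  diword_val (word_vdash a b) = mmul (diword_val a) (diword_val b).
Proof. by rewrite /word_vdash; case: insubP. Qed.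

Lemma diword_mdeg_gt0 a : (0 < mdeg (diword_val a))%N.
Proof. by rewrite lt0n mdeg_eq0 diword_val_neq1. Qed.

Lemma word_dashv_ext a b c d :
  mmul (diword_val a) (diword_val b) = mmul (diword_val c) (diword_val d) ->
  word_dashv a b = word_dashv c d.
Proof. by move=> e; congr inl; apply: val_inj. Qed.

Lemma word_vdash_ext a b c d :
  mmul (diword_val a) (diword_val b) = mmul (diword_val c) (diword_val d) ->
  word_vdash a b = word_vdash c d.
Proof.
by move=> e; rewrite /word_vdash (word_dashv_ext e) e.
Qed.

Lemma word_vdash_long a b :
  (2 < mdeg (diword_val a) + mdeg (diword_val b))%N ->
  word_vdash a b = word_dashv a b.
Proof.
move=> h; rewrite /word_vdash insubF // mdegM.
by apply/negbTE; rewrite neq_ltn h orbT.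
Qed.

Lemma mdeg3_gt2 a b c :
  (2 < mdeg (diword_val a) + (mdeg (diword_val b) + mdeg (diword_val c)))%N.
Proof.
by rewrite -[3%N]/(1 + (1 + 1))%N !leq_add ?diword_mdeg_gt0.
Qed.

Lemma word_vdashA : associative word_vdash.
Proof.
move=> a b c.
rewrite (@word_vdash_long a (word_vdash b c)) ?(@word_vdash_long (word_vdash a b) c).
- by apply: word_dashv_ext; rewrite !word_vdash_val mulmA.
- by rewrite word_vdash_val mdegM -addnA mdeg3_gt2.
- by rewrite word_vdash_val mdegM mdeg3_gt2.
Qed.

Lemma word_dashvA : associative word_dashv.
Proof. by move=> a b c; apply: word_dashv_ext; rewrite /= mulmA. Qed.

Lemma word_vdashC : commutative word_vdash.
Proof. by move=> a b; apply: word_vdash_ext; rewrite mulmC. Qed.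

Lemma word_dashvC : commutative word_dashv.
Proof. by move=> a b; apply: word_dashv_ext; rewrite mulmC. Qed.

Lemma word_dashv_vdash a b c :
  word_dashv a (word_vdash b c) = word_dashv a (word_dashv b c).
Proof. by apply: word_dashv_ext; rewrite word_vdash_val. Qed.

Lemma word_vdash_dashv a b c :
  word_vdash (word_dashv a b) c = word_vdash (word_vdash a b) c.
Proof. by apply: word_vdash_ext; rewrite word_vdash_val. Qed.

Lemma word_vdash_dashvA a b c :
  word_vdash a (word_dashv b c) = word_dashv (word_vdash a b) c.
Proof.
rewrite word_vdash_long ?mdegM ?mdeg3_gt2 //.
by apply: word_dashv_ext; rewrite word_vdash_val /= mulmA.
Qed.
End Words.

Section BilinearExtension.
Context (k : fieldType) (B : choiceType) (op : B -> B -> B).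

Definition bilin_ext (f g : {malg k[B]}) : {malg k[B]} :=
  \sum_(a <- msupp f) \sum_(b <- msupp g) << f@_a * g@_b *g op a b >>.

Local Open Scope fset_scope.

Lemma bilin_extEw (d e : {fset B}) f g : msupp f `<=` d -> msupp g `<=` e ->
  bilin_ext f g = \sum_(a <- d) \sum_(b <- e) << f@_a * g@_b *g op a b >>.
Proof.
move=> fd ge; rewrite /bilin_ext (big_fset_incl _ fd) /=; last first.
  move=> a _ /mcoeff_outdom ->; rewrite big1 // => b _.
  by rewrite mul0r monalgU0.
apply: eq_bigr => a _; rewrite (big_fset_incl _ ge) //= => b _ /mcoeff_outdom ->.
by rewrite mulr0 monalgU0.
Qed.

Lemma malgZU (c x : k) (b : B) : c *: << x *g b >> = << c * x *g b >> :> {malg k[B]}.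
Proof. by apply/malgP => a; rewrite mcoeffZ !mcoeffU mulrnAr. Qed.

Lemma bilin_ext_linearl g : linear (bilin_ext^~ g).
Proof.
move=> c f1 f2; set d := msupp (c *: f1 + f2) `|` msupp f1 `|` msupp f2.
have [s1 s2 s3] : [/\ msupp (c *: f1 + f2) `<=` d, msupp f1 `<=` d & msupp f2 `<=` d].
  by split; apply/fsubsetP => a; rewrite !inE => ->; rewrite ?orbT.
rewrite (bilin_extEw s1 (fsubset_refl _)) (bilin_extEw s2 (fsubset_refl _)).
rewrite (bilin_extEw s3 (fsubset_refl _)).
rewrite scaler_sumr -big_split /=; apply: eq_bigr => a _.
rewrite scaler_sumr -big_split /=; apply: eq_bigr => b _.
by rewrite malgZU -monalgUD mcoeffD mcoeffZ mulrDl mulrA.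
Qed.

Lemma bilin_ext_linearr f : linear (bilin_ext f).
Proof.
move=> c g1 g2; set d := msupp (c *: g1 + g2) `|` msupp g1 `|` msupp g2.
have [s1 s2 s3] : [/\ msupp (c *: g1 + g2) `<=` d, msupp g1 `<=` d & msupp g2 `<=` d].
  by split; apply/fsubsetP => a; rewrite !inE => ->; rewrite ?orbT.
rewrite (bilin_extEw (fsubset_refl _) s1) (bilin_extEw (fsubset_refl _) s2).
rewrite (bilin_extEw (fsubset_refl _) s3).
rewrite scaler_sumr -big_split /=; apply: eq_bigr => a _.
rewrite scaler_sumr -big_split /=; apply: eq_bigr => b _.
by rewrite malgZU -monalgUD mcoeffD mcoeffZ mulrDr mulrCA.
Qed.

Lemma bilin_extU x y a b :
  bilin_ext << x *g a >> << y *g b >> = << x * y *g op a b >>.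
Proof.
rewrite (bilin_extEw msuppU_le msuppU_le) !big_seq_fset1.
by rewrite !mcoeffUU.
Qed.

Lemma malg_linear_ext (V : lmodType k) (F G : {malg k[B]} -> V) :
    linear F -> linear G -> (forall b, F << b >> = G << b >>) -> F =1 G.
Proof.
move=> linF linG FG f.
have lin0 (H : {malg k[B]} -> V) : linear H -> H 0 = 0.
  by move=> linH; have := linH (-1) 0 0; rewrite scaler0 addr0 scaleN1r addNr.
rewrite (monalgE f); elim: (enum_fset (msupp f)) => [|b s IH].
  by rewrite !big_nil !lin0.
rewrite !big_cons -[f@_b]mulr1 -malgZU.
by rewrite linF linG FG IH.
Qed.
End BilinearExtension.

(* An identity between trilinear expressions holds as soon as it holds on
   basis elements. *)
Lemma malg_trilinear_ext (k : fieldType) (B : choiceType) (V : lmodType k)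
    (F G : {malg k[B]} -> {malg k[B]} -> {malg k[B]} -> V) :
    (forall g h, linear (fun f => F f g h)) -> (forall f h, linear (fun g => F f g h)) ->
    (forall f g, linear (F f g)) ->
    (forall g h, linear (fun f => G f g h)) -> (forall f h, linear (fun g => G f g h)) ->
    (forall f g, linear (G f g)) ->
    (forall a b c, F << a >> << b >> << c >> = G << a >> << b >> << c >>) ->
  forall f g h, F f g h = G f g h.
Proof.
move=> F1 F2 F3 G1 G2 G3 FG f g h.
apply: (malg_linear_ext (F1 g h) (G1 g h)) => a.
apply: (malg_linear_ext (F2 _ h) (G2 _ h)) => b.
by apply: (malg_linear_ext (F3 _ _) (G3 _ _)) => c.
Qed.

Definition Di (k : fieldType) (X : choiceType) := {malg k[diword X]}.

Section FreeCommDialgebra.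
Context (k : fieldType) (X : choiceType).

HB.instance Definition _ := Choice.on (Di k X).
HB.instance Definition _ := GRing.Lmodule.on (Di k X).

Definition di_vdash : Di k X -> Di k X -> Di k X := bilin_ext (@word_vdash X).
Definition di_dashv : Di k X -> Di k X -> Di k X := bilin_ext (@word_dashv X).

Local Notation vd := di_vdash.
Local Notation dv := di_dashv.

Local Ltac on_basis :=
  try (move=> ? ? ? ? ?; rewrite /= /di_vdash /di_dashv
         ?(bilin_ext_linearl, bilin_ext_linearr); reflexivity);
  move=> a b c; rewrite /di_vdash /di_dashv !bilin_extU.

Lemma di_vdashA : associative di_vdash.
Proof.
apply: (malg_trilinear_ext (F := fun f g h => vd f (vd g h))
                           (G := fun f g h => vd (vd f g) h)); on_basis.
by rewrite word_vdashA mulrA.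
Qed.

Lemma di_dashvA : associative di_dashv.
Proof.
apply: (malg_trilinear_ext (F := fun f g h => dv f (dv g h))
                           (G := fun f g h => dv (dv f g) h)); on_basis.
by rewrite word_dashvA mulrA.
Qed.

Lemma di_dashv_vdash f g h : dv f (vd g h) = dv f (dv g h).
Proof.
move: f g h; apply: (malg_trilinear_ext (F := fun f g h => dv f (vd g h))
                           (G := fun f g h => dv f (dv g h))); on_basis.
by rewrite word_dashv_vdash.
Qed.

Lemma di_vdash_dashv f g h : vd (dv f g) h = vd (vd f g) h.
Proof.
move: f g h; apply: (malg_trilinear_ext (F := fun f g h => vd (dv f g) h)
                           (G := fun f g h => vd (vd f g) h)); on_basis.
by rewrite word_vdash_dashv.
Qed.

Lemma di_vdash_dashvA f g h : vd f (dv g h) = dv (vd f g) h.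
Proof.
move: f g h; apply: (malg_trilinear_ext (F := fun f g h => vd f (dv g h))
                           (G := fun f g h => dv (vd f g) h)); on_basis.
by rewrite word_vdash_dashvA mulrA.
Qed.

Lemma bilin_extC (B : choiceType) (op : B -> B -> B) :
  commutative op -> commutative (@bilin_ext k B op).
Proof.
move=> opC f g; rewrite /bilin_ext exchange_big /=.
by apply: eq_bigr => a _; apply: eq_bigr => b _; rewrite opC mulrC.
Qed.

HB.instance Definition _ := isCommDialgebra.Build k (Di k X)
  (fun w => @bilin_ext_linearl k _ (@word_vdash X) w)
  (fun u => @bilin_ext_linearr k _ (@word_vdash X) u)
  (fun w => @bilin_ext_linearl k _ (@word_dashv X) w)
  (fun u => @bilin_ext_linearr k _ (@word_dashv X) u)
  di_vdashA di_dashvA (bilin_extC (@word_vdashC X)) (bilin_extC (@word_dashvC X))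
  di_dashv_vdash di_vdash_dashv di_vdash_dashvA.
End FreeCommDialgebra.

(** ** Algorithms over k

    Data are finite binary trees whose leaves are [Nil] or elements of k.
    Programs are those of a while language in which the field operations and
    the equality test of k are primitive instructions; a program may contain
    finitely many fixed trees, hence fixed elements of k such as the
    coefficients of the relations of a given presentation. Elements of k are
    otherwise opaque: they can only be copied, combined and compared. *)

Inductive tree (K : Type) := Nil | Atom of K | Cons of tree K & tree K.
Arguments Nil {K}.
Arguments Atom {K}.
Arguments Cons {K}.

Inductive instr := Head | Tail | Add | Mul | Opp | Inv | EqTest.

Inductive prog (K : Type) :=
| Skip
| Const of tree K
| Instr of instr
| Pair of prog K & prog K
| Seq of prog K & prog K
| If of prog K & prog K & prog K
| While of prog K & prog K.
Arguments Skip {K}.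
Arguments Const {K}.
Arguments Instr {K}.
Arguments Pair {K}.
Arguments Seq {K}.
Arguments If {K}.
Arguments While {K}.

Definition enc_nat K (n : nat) : tree K := iter n (Cons Nil) Nil.
Definition enc_bool K (b : bool) : tree K := enc_nat K b.
Definition enc_seq K T (enc : T -> tree K) (s : seq T) : tree K :=
  foldr (fun x t => Cons (enc x) t) Nil s.

Section Semantics.
Context (k : fieldType).

(* [None]: the instruction does not apply and execution is stuck. *)
Definition instr_sem (i : instr) (t : tree k) : option (tree k) :=
  match i, t with
  | Head, Cons t1 _ => Some t1
  | Tail, Cons _ t2 => Some t2
  | Add, Cons (Atom a) (Atom b) => Some (Atom (a + b))
  | Mul, Cons (Atom a) (Atom b) => Some (Atom (a * b))
  | Opp, Atom a => Some (Atom (- a))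
  | Inv, Atom a => Some (Atom a^-1)
  | EqTest, Cons (Atom a) (Atom b) => Some (enc_bool k (a == b))
  | _, _ => None
  end.

(* [eval p s t]: started on s, the program p halts with output t. *)
Inductive eval : prog k -> tree k -> tree k -> Prop :=
| eval_skip t : eval Skip t t
| eval_const c t : eval (Const c) t c
| eval_instr i s t of instr_sem i s = Some t : eval (Instr i) s t
| eval_pair p q s t1 t2 of eval p s t1 & eval q s t2 :
    eval (Pair p q) s (Cons t1 t2)
| eval_seq p q s t u of eval p s t & eval q t u : eval (Seq p q) s u
| eval_if_false c p q s t of eval c s Nil & eval q s t : eval (If c p q) s t
| eval_if_true c p q s b t of eval c s b & b <> Nil & eval p s t :
    eval (If c p q) s t
| eval_while_stop c p s of eval c s Nil : eval (While c p) s s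
| eval_while_loop c p s b t u of eval c s b & b <> Nil & eval p s t &
    eval (While c p) t u : eval (While c p) s u.

Lemma eval_det p s t u : eval p s t -> eval p s u -> t = u.
Proof.
move=> e; elim: e u => {p s t};
  intros; match goal with H : eval _ _ ?u |- _ = ?u => inversion H; subst end;
  repeat match goal with
  | IH : forall u, eval ?p ?s u -> _ = u, H : eval ?p ?s ?t |- _ =>
      move: (IH _ H); clear H; intro; subst
  end; congruence.
Qed.
End Semantics.

(** ** Elements of the free commutative dialgebra as inputs *)

Section Encoding.
Context (k : fieldType) (X : finType).

Definition lincomb (s : seq (diword X * k)) : Di k X :=
  \sum_(bc <- s) << bc.2 *g bc.1 >>.

Definition diword_index (a : diword X) : nat := if a is inl _ then 1%N else 2%N.

(* A word is encoded by its index and its vector of exponents. *)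
Definition enc_diword (a : diword X) : tree k :=
  Cons (enc_nat k (diword_index a))
       (enc_seq (enc_nat k) [seq diword_val a x | x <- enum X]).

Definition enc_lincomb (s : seq (diword X * k)) : tree k :=
  enc_seq (fun bc => Cons (enc_diword bc.1) (Atom bc.2)) s.
End Encoding.

(* Main.v *)
Require Import Defs.
From mathcomp Require Import all_boot all_order all_algebra.
From mathcomp Require Import finmap.
From mathcomp Require Import monalg.
From Stdlib Require Import Classical.
Import Defs.

(** The proof is a Groebner basis argument for ideals of the free commutative
    dialgebra.

    Order the basis words first by index and then lexicographically by
    exponents; this is a well-order ([wlt_wf]).  Let I be an ideal and call a
    word leading if it is the greatest word of some monic element of I.  Two
    facts make finitely many leading words enough.  If the leading word of f in
    I has index 1, then all words of f have index 1, because index 2 is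
    greater; on such elements multiplication by a word only multiplies
    monomials, so that every multiple of the leading word is again leading, with
    a multiple of f as witness.  There are finitely many words of index 2, as
    they have length 2.  Dickson's lemma ([dickson]), used so as to keep the two
    indices apart, thus yields a finite list of pairs (leading word, element of
    I) such that every leading word is a multiple of one of the listed words
    with the same index ([basis_exists]).

    Each pair (a, f) is a rewriting rule that replaces a multiple of a by
    smaller words without changing the class modulo I ([rewrite_term_sound]).
    Rewriting terminates because the order is well-founded
    ([normalizes_term]); its result is a combination of words none of which is
    leading, and such a combination lies in I only if it is 0
    ([normal_ideal_eq0]).  So f belongs to I exactly when its normal form is 0.

    Once X and S are fixed, the rules are a finite amount of data, which the
    program contains as constants; only their application is computed.  It keeps
    a worklist of terms, rewrites or sets aside its first term until none is
    left, and never compares words for the order nor collects equal terms.  Only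
    at the end are the coefficients of equal words added up and compared with 0
    ([vanishes]).  The program is obtained by composing closure properties of
    the class of functions that programs compute. *)

Set Implicit Arguments.
Unset Strict Implicit.
Unset Printing Implicit Defensive.

Import Order.TTheory GRing.Theory.

(** * Functions computed by programs *)

Section Computability.
Context (k : fieldType).

(** The instances agree definitionally with the encodings of inputs and outputs
    of programs, so that inference chooses the right tree for each type. *)
Class Code (A : Type) := code : A -> tree k.

#[global] Instance unit_code : Code unit := fun=> Nil.
#[global] Instance nat_code : Code nat := enc_nat k.
#[global] Instance bool_code : Code bool := enc_bool k.
#[global] Instance scalar_code : Code k := Atom.
#[global] Instance pair_code A B (cA : Code A) (cB : Code B) : Code (A * B) :=
  fun x => Cons (code x.1) (code x.2).
#[global] Instance seq_code A (cA : Code A) : Code (seq A) := enc_seq cA.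

Definition computable A B {cA : Code A} {cB : Code B} (F : A -> B) :=
  exists p : prog k, forall x, eval p (code x) (code (F x)).

Section Combinators.
Context (A B C : Type) {cA : Code A} {cB : Code B} {cC : Code C}.

Lemma computable_ext (F G : A -> B) : F =1 G -> computable F -> computable G.
Proof. by move=> e [p hp]; exists p => x; rewrite -e. Qed.

Lemma computable_id : computable (fun x : A => x).
Proof. by exists Skip => x; constructor. Qed.

Lemma computable_cst (c : B) : computable (fun _ : A => c).
Proof. by exists (Const (code c)) => x; constructor. Qed.

Lemma computable_comp (G : B -> C) (F : A -> B) :
  computable G -> computable F -> computable (fun x => G (F x)).
Proof. by move=> [q hq] [p hp]; exists (Seq p q) => x; econstructor. Qed.

Lemma computable_pair (F : A -> B) (G : A -> C) :
  computable F -> computable G -> computable (fun x => (F x, G x)).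
Proof. by move=> [p hp] [q hq]; exists (Pair p q) => x; constructor. Qed.

Lemma computable_fst (F : A -> B * C) :
  computable F -> computable (fun x => (F x).1).
Proof.
by move=> [p hp]; exists (Seq p (Instr Head)) => x; econstructor => //; constructor.
Qed.

Lemma computable_snd (F : A -> B * C) :
  computable F -> computable (fun x => (F x).2).
Proof.
by move=> [p hp]; exists (Seq p (Instr Tail)) => x; econstructor => //; constructor.
Qed.

Lemma computable_if (b : A -> bool) (F G : A -> B) :
  computable b -> computable F -> computable G ->
  computable (fun x => if b x then F x else G x).
Proof.
move=> [p hp] [q hq] [r hr]; exists (If p q r) => x; have := hp x.
by case: (b x) => e; [apply: eval_if_true e _ _ | apply: eval_if_false].
Qed.

Lemma computable_cons (F : A -> B) (G : A -> seq B) :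
  computable F -> computable G -> computable (fun x => F x :: G x).
Proof. by move=> [p hp] [q hq]; exists (Pair p q) => x; constructor. Qed.

Lemma computable_head (b : B) (F : A -> seq B) :
  computable F -> computable (fun x => head b (F x)).
Proof.
move=> [p hp]; exists (Seq p (If Skip (Instr Head) (Const (code b)))) => x.
apply: eval_seq (hp x) _; case: (F x) => [|y s].
  by apply: eval_if_false; constructor.
by apply: eval_if_true; [constructor| |constructor].
Qed.

Lemma computable_behead (F : A -> seq B) :
  computable F -> computable (fun x => behead (F x)).
Proof.
move=> [p hp]; exists (Seq p (If Skip (Instr Tail) (Const Nil))) => x.
apply: eval_seq (hp x) _; case: (F x) => [|y s].
  by apply: eval_if_false; constructor.
by apply: eval_if_true; [constructor| |constructor].
Qed.

(** A while loop on the state [((x, b), s)]: [x] is kept as an environment for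
    [step], and the tree of [s] itself serves as the loop condition, being [Nil]
    exactly when [s] is exhausted. *)
Lemma computable_foldl (step : A -> B -> C -> B) (b : A -> B) (s : A -> seq C) :
  computable (fun z : A * B * C => step z.1.1 z.1.2 z.2) ->
  computable b -> computable s ->
  computable (fun x => foldl (step x) (b x) (s x)).
Proof.
move=> [p hp] [q hq] [r hr].
pose body := Pair
  (Pair (Seq (Instr Head) (Instr Head))
        (Seq (Pair (Instr Head) (Seq (Instr Tail) (Instr Head))) p))
  (Seq (Instr Tail) (Instr Tail)).
exists (Seq (Pair (Pair Skip q) r)
  (Seq (While (Instr Tail) body) (Seq (Instr Head) (Instr Tail)))) => x.
apply: (@eval_seq _ _ _ _ (code (x, b x, s x))); first by do !constructor.
move: (b x) (s x) => {q r hq hr}b {}s.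
apply: (@eval_seq _ _ _ _ (code (x, foldl (step x) b s, [::] : seq C))); last first.
  by apply: eval_seq; apply: eval_instr.
elim: s b => [|c s IHs] b /=; first by apply: eval_while_stop; constructor.
apply: (@eval_while_loop _ _ _ _ (code (c :: s)) _ _ _ _ _ (IHs _)) => //.
  exact: eval_instr.
apply: eval_pair; last by apply: eval_seq; apply: eval_instr.
apply: eval_pair; first by apply: eval_seq; apply: eval_instr.
apply: eval_seq (hp (x, b, c)); apply: eval_pair; first exact: eval_instr.
by apply: eval_seq; apply: eval_instr.
Qed.
End Combinators.

Section Nat.
Context (A : Type) {cA : Code A}.

Lemma computable_succ (f : A -> nat) : computable f -> computable (fun x => (f x).+1).
Proof. by move=> [p hp]; exists (Pair (Const Nil) p) => x; do !constructor. Qed.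

(** Numbers are encoded in unary: [n] and a list of [n] units have the same
    tree. Iteration is thereby an instance of folding. *)
Lemma computable_nseq (f : A -> nat) :
  computable f -> computable (fun x => nseq (f x) tt).
Proof.
move=> [p hp]; exists p => x; rewrite (_ : code (nseq _ _) = code (f x)) //.
by elim: (f x) => // n IHn; apply: (congr1 (Cons Nil) IHn).
Qed.

Lemma computable_iter B {cB : Code B} (step : A -> B -> B) (b : A -> B) (f : A -> nat) :
  computable (fun z : A * B => step z.1 z.2) -> computable b -> computable f ->
  computable (fun x => iter (f x) (step x) (b x)).
Proof.
move=> cstep cb /computable_nseq cf.
apply: (@computable_ext _ _ _ _
  (fun x => foldl (fun y _ => step x y) (b x) (nseq (f x) tt))).
  by move=> x; elim: (f x) (b x) => // n IHn y; rewrite iterSr -IHn.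
apply: computable_foldl => //; apply: (computable_comp cstep).
exact/computable_fst/computable_id.
Qed.

Lemma computable_pred (f : A -> nat) : computable f -> computable (fun x => (f x).-1).
Proof.
move=> /computable_nseq /computable_behead [p hp]; exists p => x.
rewrite (_ : code (f x).-1 = code (behead (nseq (f x) tt))) //.
by case: (f x) => //= n; elim: n => // n IHn; apply: (congr1 (Cons Nil) IHn).
Qed.
End Nat.

Section Arith.
Context (A : Type) {cA : Code A} (f g : A -> nat).
Hypotheses (cf : computable f) (cg : computable g).

Lemma computable_addn : computable (fun x => (f x + g x)%N).
Proof.
apply: (@computable_ext _ _ _ _ (fun x => iter (f x) (fun n => n.+1) (g x))).
  by move=> x; rewrite iter_succn addnC.
by apply: computable_iter => //; apply/computable_succ/computable_snd/computable_id.
Qed.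

Lemma computable_subn : computable (fun x => (f x - g x)%N).
Proof.
apply: (@computable_ext _ _ _ _ (fun x => iter (g x) (fun n => n.-1) (f x))).
  by move=> x; rewrite iter_predn.
by apply: computable_iter => //; apply/computable_pred/computable_snd/computable_id.
Qed.
End Arith.

Section Tests.
Context (A : Type) {cA : Code A}.

Lemma computable_eqn0 (f : A -> nat) : computable f -> computable (fun x => f x == 0%N).
Proof.
move=> [p hp]; exists (Seq p (If Skip (Const (code false)) (Const (code true)))) => x.
apply: eval_seq (hp x) _; case: (f x) => [|n].
  by apply: eval_if_false; constructor.
by apply: eval_if_true; [constructor| |constructor].
Qed.

Lemma computable_leq (f g : A -> nat) :
  computable f -> computable g -> computable (fun x => (f x <= g x)%N).
Proof. by move=> cf cg; apply/computable_eqn0/computable_subn. Qed.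

Lemma computable_and (b c : A -> bool) :
  computable b -> computable c -> computable (fun x => b x && c x).
Proof. by move=> cb cc; apply: computable_if => //; apply: computable_cst. Qed.

Lemma computable_eqn (f g : A -> nat) :
  computable f -> computable g -> computable (fun x => f x == g x).
Proof.
move=> cf cg; apply: (@computable_ext _ _ _ _ (fun x => (f x <= g x)%N && (g x <= f x)%N)).
  by move=> x; rewrite eqn_leq.
by apply: computable_and; apply: computable_leq.
Qed.

Lemma computable_nth (i : nat) (s : A -> seq nat) :
  computable s -> computable (fun x => nth 0%N (s x) i).
Proof.
move=> cs; apply: (@computable_ext _ _ _ _ (fun x => head 0%N (iter i behead (s x)))).
  by move=> x; elim: i (s x) => [|i IHi] t; [case: t | rewrite iterSr IHi nth_behead].
by apply: computable_head; elim: i => //= i; apply: computable_behead.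
Qed.

(** The index list [r] is fixed in advance, so the program is unrolled over it
    and the tests may differ from one index to the next without any uniformity.
    The same holds of [computable_map]. *)
Lemma computable_all (I : Type) (r : seq I) (P : I -> A -> bool) :
  (forall i, computable (P i)) -> computable (fun x => all (P^~ x) r).
Proof.
move=> cP; elim: r => [|i r IHr] /=; first exact: computable_cst.
exact: computable_and.
Qed.

Lemma computable_map B {cB : Code B} (I : Type) (r : seq I) (F : I -> A -> B) (s : A -> seq B) :
  (forall i, computable (F i)) -> computable s ->
  computable (fun x => [seq F i x | i <- r] ++ s x).
Proof.
by move=> cF cs; elim: r => [|i r IHr] //=; apply: computable_cons.
Qed.

Lemma computable_instr2 (i : instr) (op : k -> k -> k) (f g : A -> k) :
  (forall a b, instr_sem i (Cons (Atom a) (Atom b)) = Some (Atom (op a b))) ->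
  computable f -> computable g -> computable (fun x => op (f x) (g x)).
Proof.
move=> e [p hp] [q hq]; exists (Seq (Pair p q) (Instr i)) => x.
by apply: (eval_seq (eval_pair (hp x) (hq x))); apply: eval_instr; exact: e.
Qed.

Lemma computable_eq_scalar (f g : A -> k) :
  computable f -> computable g -> computable (fun x => f x == g x).
Proof.
move=> [p hp] [q hq]; exists (Seq (Pair p q) (Instr EqTest)) => x.
by apply: (eval_seq (eval_pair (hp x) (hq x))); apply: eval_instr.
Qed.

End Tests.

(** A loop that need not stop on every state is described by how its runs
    extend; termination is proved separately, along a well-founded order. *)
Lemma computable_while A B {cA : Code A} {cB : Code B} (step : seq A * B -> seq A * B) :
  computable step ->
  exists p : prog k,
    (forall b, eval p (code ([::] : seq A, b)) (code ([::] : seq A, b))) /\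
    (forall a s b t, eval p (code (step (a :: s, b))) t -> eval p (code (a :: s, b)) t).
Proof.
move=> [p hp]; exists (While (Instr Head) p); split => [b|a s b t].
  by apply: eval_while_stop; apply: eval_instr.
by apply: (@eval_while_loop _ _ _ _ (code (a :: s)) _ _ (eval_instr _)).
Qed.

(** * The rewriting program *)

Context (X : finType).

(** The coordinates of an encoded word: [None] for its index, [Some x] for its
    exponent at [x]. *)
Definition coords : seq (option X) := None :: [seq Some x | x <- enum X].

Definition coord (o : option X) (w : seq nat) : nat :=
  nth 0 w (if o is Some x then (enum_rank x).+1 else 0).

Definition term := (seq nat * k)%type.
Definition rule := (seq nat * seq term)%type.

(** Divisibility of [w] by [u], together with equality of the indices: the
    first test is the converse of the instance of the second at [None]. *)
Definition matches (u w : seq nat) : bool :=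
  (coord None w <= coord None u)%N && all (fun o => coord o u <= coord o w)%N coords.

(** The exponents of [t * (w / u)], computed on indices as well: under
    [matches u w] the index of [t] is kept. *)
Definition translate (u t w : seq nat) : seq nat :=
  [seq (coord o t + (coord o w - coord o u))%N | o <- coords].

Definition rewrite_term (r : rule) (t : term) : seq term :=
  [seq (translate r.1 m.1 t.1, (m.2 * t.2)%R) | m <- r.2].

(** The state is a worklist and the list of the terms found irreducible. *)
Definition step (rules : seq rule) (st : seq term * seq term) : seq term * seq term :=
  let t := head ([::], 0%R) st.1 in
  foldr (fun r st' => if matches r.1 t.1 then (rewrite_term r t ++ behead st.1, st.2)
                      else st')
    (behead st.1, t :: st.2) rules.

Definition same_word (u w : seq nat) := all (fun o => coord o u == coord o w) coords.

Definition coef (s : seq term) (w : seq nat) : k :=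
  foldl (fun c t => if same_word t.1 w then (t.2 + c)%R else c) 0%R s.

Definition vanishes (s : seq term) : bool :=
  foldl (fun b t => if coef s t.1 == 0%R then b else false) true s.

Lemma computable_coord A {cA : Code A} o (w : A -> seq nat) :
  computable w -> computable (fun x => coord o (w x)).
Proof. exact: computable_nth. Qed.

Lemma computable_matches A {cA : Code A} u (w : A -> seq nat) :
  computable w -> computable (fun x => matches u (w x)).
Proof.
move=> cw; apply: computable_and.
  by apply: computable_leq; [exact: computable_coord | exact: computable_cst].
apply: (@computable_all _ _ _ _ (fun o x => _)) => o.
by apply: computable_leq; [exact: computable_cst | exact: computable_coord].
Qed.

Lemma computable_translate A {cA : Code A} u t (w : A -> seq nat) :
  computable w -> computable (fun x => translate u t (w x)).
Proof.
move=> cw.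
apply: (@computable_ext _ _ _ _ (fun x => translate u t (w x) ++ [::])).
  by move=> x; rewrite cats0.
apply: (@computable_map _ _ _ _ _ coords
  (fun o x => (coord o t + (coord o (w x) - coord o u))%N) (fun=> [::])) => [o|].
  apply: computable_addn; first exact: computable_cst.
  by apply: computable_subn; [exact: computable_coord | exact: computable_cst].
exact: computable_cst.
Qed.

Lemma computable_step rules : computable (step rules).
Proof.
have cw1 : computable (fun st : seq term * seq term => behead st.1).
  exact/computable_behead/computable_fst/computable_id.
have ct : computable (fun st : seq term * seq term => head ([::], 0%R) st.1).
  exact/computable_head/computable_fst/computable_id.
have cw2 : computable (fun st : seq term * seq term => st.2).
  exact/computable_snd/computable_id.
rewrite /step; elim: rules => [|r rules IHr] /=.
  by apply: computable_pair => //; apply: computable_cons.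
apply: computable_if => //; first exact/computable_matches/computable_fst.
apply: computable_pair => //.
apply: (@computable_map _ _ _ _ _ r.2 (fun m (st : seq term * seq term) =>
  (translate r.1 m.1 (head ([::], 0%R) st.1).1, (m.2 * (head ([::], 0%R) st.1).2)%R))) => // m.
apply: computable_pair; first exact/computable_translate/computable_fst.
apply: (computable_instr2 (i := Mul)) => //; first exact: computable_cst.
exact: computable_snd.
Qed.

Lemma computable_vanishes : computable vanishes.
Proof.
apply: (computable_foldl (step := fun s b t => if coef s t.1 == 0%R then b else false));
  [| exact: computable_cst | exact: computable_id].
apply: computable_if; last exact: computable_cst; last first.
  exact/computable_snd/computable_fst/computable_id.
apply: computable_eq_scalar; last exact: computable_cst.
apply: (computable_foldl
  (step := fun z c t => if same_word t.1 z.2.1 then (t.2 + c)%R else c)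
  (s := fun z => z.1.1)); last exact/computable_fst/computable_fst/computable_id.
  have ct : computable (fun z : seq term * bool * term * k * term => z.2).
    exact/computable_snd/computable_id.
  have cc : computable (fun z : seq term * bool * term * k * term => z.1.2).
    exact/computable_snd/computable_fst/computable_id.
  apply: computable_if => //.
    apply: (@computable_all _ _ _ _ (fun o z => _)) => o.
    apply: computable_eqn; apply: computable_coord; apply: computable_fst => //.
    exact/computable_snd/computable_fst/computable_fst/computable_id.
  by apply: (computable_instr2 (i := Add)) => //; exact: computable_snd.
exact: computable_cst.
Qed.
End Computability.

(** * Combinatorics of exponent vectors *)

Definition lexlt (s t : seq nat) : bool := ((s : seqlexi nat) < (t : seqlexi nat))%O.
Definition lexle (s t : seq nat) : bool := ((s : seqlexi nat) <= (t : seqlexi nat))%O.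

Lemma lexlt_cons i j s t : lexlt (i :: s) (j :: t) = (i < j)%N || (i == j) && lexlt s t.
Proof. by rewrite /lexlt ltxi_cons !leEnat; case: ltngtP. Qed.

(** The length must be fixed: without it the lexicographic order on lists is not
    well-founded, as [1] > [0; 1] > [0; 0; 1] > ... shows. *)
Lemma lexlt_wf n s : size s = n -> Acc (fun u v => size u = n /\ lexlt u v) s.
Proof.
elim: n s => [|n IHn] s.
  by move/size0nil=> ->; constructor=> t [/size0nil ->].
case: s => [|i s [ss]]; first by move/O_S.
elim/ltn_ind: i s ss => i IHi s ss.
move: (ss); elim: (IHn s ss) => {}s _ IHs {}ss; constructor=> -[|j t] []; first by move/O_S.
move=> [st].
rewrite lexlt_cons => /orP [ij|/andP [/eqP -> ts]]; first exact: IHi.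
exact: IHs.
Qed.

(** The order is compatible with multiplication of monomials, which adds their
    exponents. *)
Lemma lexlt_map_addl T (h f g : T -> nat) (r : seq T) :
  lexlt [seq f i | i <- r] [seq g i | i <- r] ->
  lexlt [seq (h i + f i)%N | i <- r] [seq (h i + g i)%N | i <- r].
Proof.
by elim: r => //= i r IHr; rewrite !lexlt_cons ltn_add2l eqn_add2l => /orP [-> //|/andP [-> /IHr ->]]; rewrite orbT.
Qed.

Lemma max_exists (T : eqType) (c : T -> seq nat) (s : seq T) : s != [::] ->
  exists2 a, a \in s & forall b, b \in s -> lexle (c b) (c a).
Proof.
elim: s => // a [_ _|b s /(_ isT) [m ms mP] _].
  by exists a; rewrite ?mem_head // => b; rewrite inE => /eqP ->; rewrite /lexle lexx.
have [am|/ltW ma] := leP (c a : seqlexi nat) (c m).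
  by exists m; rewrite 1?inE ?ms ?orbT // => x; rewrite inE => /predU1P [->|/mP].
exists a; rewrite ?mem_head // => x; rewrite inE => /predU1P [->|/mP]; rewrite /lexle ?lexx //.
by move=> xm; apply: le_trans ma.
Qed.

(** Dickson's lemma, by induction on the number [n] of coordinates. Dropping the
    first coordinate gives a finite [B0] that dominates in the other ones; if [M]
    bounds the first coordinates of [B0], then [B0] suffices for the elements
    whose first coordinate is at least [M]. Each smaller value of the first
    coordinate is a separate instance of the induction hypothesis. *)
Lemma dickson (T : eqType) n (c : T -> seq nat) (P : T -> Prop) :
  (forall t, P t -> size (c t) = n) ->
  exists2 B : seq T, (forall b, b \in B -> P b) &
    forall t, P t -> exists2 b, b \in B & all2 leq (c b) (c t).
Proof.
elim: n c P => [|n IHn] c P sz.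
  have [[t Pt]|nP] := classic (exists t, P t).
    exists [:: t] => [b|u Pu]; first by rewrite inE => /eqP ->.
    by exists t; rewrite ?mem_head // (size0nil (sz t Pt)) (size0nil (sz u Pu)).
  by exists [::] => // t Pt; case: nP; exists t.
have szb t : P t -> size (behead (c t)) = n by move=> /sz; rewrite size_behead => ->.
have [B0 B0P B0c] := IHn (fun t => behead (c t)) P szb.
pose h t := head 0%N (c t).
have all2E b t : P b -> P t -> (h b <= h t)%N -> all2 leq (behead (c b)) (behead (c t)) ->
    all2 leq (c b) (c t).
  by move=> /sz + /sz; rewrite /h; case: (c b) (c t) => [|? ?] [|? ?] //= _ _ -> ->.
have [M B0M] : exists M, forall b, b \in B0 -> (h b <= M)%N.
  elim: (B0) => [|b s [M IHs]]; first by exists 0%N.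
  exists (maxn (h b) M) => x; rewrite inE => /predU1P [->|/IHs]; rewrite leq_max ?leqnn //.
  by move=> ->; rewrite orbT.
have : forall i, exists2 B : seq T, (forall b, b \in B -> P b) &
    forall t, P t -> (h t < i)%N -> exists2 b, b \in B & all2 leq (c b) (c t).
  elim=> [|i [B BP Bc]]; first by exists [::].
  have [|B' B'P B'c] := IHn (fun t => behead (c t)) (fun t => P t /\ h t = i).
    by move=> t [/szb].
  exists (B ++ B') => [b|t Pt]; first by rewrite mem_cat => /orP [/BP|/B'P []].
  rewrite ltnS leq_eqVlt => /predU1P [ht|/(Bc t Pt) [b bB bt]].
    have [b bB' bt] := B'c t (conj Pt ht); exists b; first by rewrite mem_cat bB' orbT.
    by have [Pb hb] := B'P b bB'; apply: all2E; rewrite // hb ht.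
  by exists b; rewrite // mem_cat bB.
move=> /(_ M) [B BP Bc]; exists (B0 ++ B) => [b|t Pt].
  by rewrite mem_cat => /orP [/B0P|/BP].
have [/(Bc t Pt) [b bB bt]|Mt] := ltnP (h t) M; first by exists b; rewrite // mem_cat bB orbT.
have [b bB0 bt] := B0c t Pt; exists b; first by rewrite mem_cat bB0.
exact: all2E (B0P b bB0) Pt (leq_trans (B0M b bB0) Mt) bt.
Qed.

(** * Words and their exponents *)

Section Words.
Context (X : finType).
Implicit Types (a b c : diword X) (m : {cmonom X}).

Definition entry a (o : option X) : nat :=
  if o is Some x then diword_val a x else diword_index a.

Definition wcode a : seq nat := [seq entry a o | o <- coords X].

Lemma wcodeE a : wcode a = diword_index a :: [seq diword_val a x | x <- enum X].
Proof. by rewrite /wcode /= -map_comp. Qed.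

Lemma coord_wcode a o : coord o (wcode a) = entry a o.
Proof. by rewrite wcodeE; case: o => // x; rewrite /coord /= (nth_map x) ?nth_enum_rank // -cardE ltn_ord. Qed.

Lemma size_wcode a : size (wcode a) = #|X|.+1.
Proof. by rewrite wcodeE /= size_map -cardE. Qed.

Lemma mem_coords (o : option X) : o \in coords X.
Proof. by case: o => // x; rewrite inE /= map_f ?mem_enum. Qed.

Lemma entry_inj a b : entry a =1 entry b -> a = b.
Proof.
move=> e; have := e None; have : diword_val a = diword_val b.
  by apply/eqP/cmP=> x; apply: (e (Some x)).
by case: a b {e} => [a|a] [b|b] // /val_inj ->.
Qed.

Lemma wcode_entry a b : wcode a = wcode b -> entry a =1 entry b.
Proof. by move=> e o; rewrite -!coord_wcode e. Qed.

Definition wlt a b := lexlt (wcode a) (wcode b).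

Lemma wlt_wf : well_founded (fun a b => wlt a b).
Proof.
move=> a; move e: (wcode a) => s.
have ss : size s = #|X|.+1 by rewrite -e size_wcode.
elim: {ss}(lexlt_wf ss) a e => {}s _ IHs a e; constructor=> b.
by rewrite /wlt e => bs; apply: IHs (erefl (wcode b)); rewrite size_wcode.
Qed.

(** The word [m] acting by [word_dashv], or the identity if [m] is the unit
    monomial, which is not a word. *)
Definition shift m a : diword X :=
  if insub m is Some m' then word_dashv (inl m') a else a.

(** Multiplication moves a word of index 2 to index 1; in the remaining cases it
    acts on coordinates as a translation. *)
Lemma entry_shift m a o : (diword_index a = 1 \/ m = mone)%N ->
  entry (shift m a) o = ((if o is Some x then m x else 0) + entry a o)%N.
Proof.
rewrite /shift; case: insubP => [m' m1 vm'|/negbNE /eqP ->] H.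
  case: o => [x|] /=; first by rewrite cmM vm'.
  by case: H => [-> //|m0]; rewrite m0 eqxx in m1.
by case: o => [x|] /=; rewrite ?cm1.
Qed.

Lemma matchesP a b : reflect
  (diword_index a = diword_index b /\ forall x, (diword_val a x <= diword_val b x)%N)
  (matches X (wcode a) (wcode b)).
Proof.
rewrite /matches !coord_wcode; apply: (iffP andP) => [[ba /allP ab]|[ab le_ab]].
  split=> [|x]; last by have := ab (Some x) (mem_coords _); rewrite !coord_wcode.
  by apply/eqP; rewrite eqn_leq ba andbT; have := ab None (mem_coords _); rewrite !coord_wcode.
split; first by rewrite /= ab.
by apply/allP=> -[x|] _; rewrite !coord_wcode //= ab.
Qed.

(** Here [m] is the quotient [b / a]. If [a] and [b] have index 2 they both have
    length 2, so [m] is the unit and [c] may have any index. Otherwise the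
    hypothesis on [c] forces it to have index 1. *)
Lemma entry_shift_quotient a b c (m := divcm (diword_val b) (diword_val a)) o :
  matches X (wcode a) (wcode b) -> (diword_index c <= diword_index a)%N ->
  entry (shift m c) o = (entry c o + (entry b o - entry a o))%N.
Proof.
case/matchesP=> iab le_ab ica; rewrite entry_shift.
  by case: o => [x|] /=; rewrite addnC ?divcmE ?iab ?subnn.
have mE : diword_val b = mmul m (diword_val a).
  by apply/eqP/cmP=> x; rewrite cmM divcmE subnK.
case: a b c @m iab ica {le_ab} mE => [a|a] [b|b] [c|c] //= _ _ mE; try by left.
all: right; apply/eqP; rewrite -mdeg_eq0; have := congr1 mdeg mE.
all: by rewrite mdegM (eqP (valP a)) (eqP (valP b)) => /(congr1 (subn^~ 2)); rewrite addnK => <-.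
Qed.

Lemma translate_wcode a b c :
  matches X (wcode a) (wcode b) -> (diword_index c <= diword_index a)%N ->
  translate X (wcode a) (wcode c) (wcode b)
    = wcode (shift (divcm (diword_val b) (diword_val a)) c).
Proof.
move=> ab ca; apply: eq_map => o; rewrite !coord_wcode.
by rewrite (entry_shift_quotient o ab ca).
Qed.

Lemma shift_quotient a b :
  matches X (wcode a) (wcode b) -> shift (divcm (diword_val b) (diword_val a)) a = b.
Proof.
move=> ab; apply: entry_inj => o; rewrite (entry_shift_quotient o ab) // subnKC //.
by case/matchesP: ab => e le_ab; case: o => [x|] //=; rewrite e.
Qed.

Lemma index_lexle a b : lexle (wcode a) (wcode b) -> (diword_index a <= diword_index b)%N.
Proof. by rewrite /lexle !wcodeE lexi_cons leEnat => /andP []. Qed.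

Lemma wlt_shift a b c : matches X (wcode a) (wcode b) -> wlt c a ->
  wlt (shift (divcm (diword_val b) (diword_val a)) c) b.
Proof.
move=> ab ca; have ica := index_lexle (ltW ca).
have := lexlt_map_addl (fun o => entry b o - entry a o)%N ca.
rewrite /wlt; congr lexlt; apply: eq_map => o; rewrite addnC.
  by rewrite (entry_shift_quotient o ab).
by rewrite -(entry_shift_quotient o ab) // shift_quotient.
Qed.
End Words.

(** * Ideals and their rewriting rules *)

Local Open Scope ring_scope.

Lemma Id_is_ideal (k : fieldType) (V : commDialgType k) (S : {pred V}) : is_ideal (Id S).
Proof.
split=> [J HJ _|f g If Ig J HJ SJ|c f If J HJ SJ|a f If J HJ SJ|a f If J HJ SJ|a f If J HJ SJ|a f If J HJ SJ].
- exact: ideal0.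
- by apply: idealD => //; [apply: If | apply: Ig].
- by apply: idealZ => //; apply: If.
- by apply: ideal_vdashl => //; apply: If.
- by apply: ideal_vdashr => //; apply: If.
- by apply: ideal_dashvl => //; apply: If.
- by apply: ideal_dashvr => //; apply: If.
Qed.

Section Rewriting.
Context (k : fieldType) (X : finType) (I : Di k X -> Prop) (idealI : is_ideal I).
Implicit Types (a b c : diword X) (f g : Di k X) (m : {cmonom X}) (s : seq (diword X * k)).

Lemma idealB f g : I f -> I g -> I (f - g).
Proof. by move=> If Ig; rewrite -scaleN1r; apply: idealD => //; apply: idealZ. Qed.

Lemma ideal_congr f g : I (f - g) -> I f <-> I g.
Proof.
move=> Ifg; split=> [If|Ig]; last by rewrite -(subrK g f); apply: idealD.
by rewrite -(subKr f g); apply: idealB.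
Qed.

(** For [m] different from the unit the sum is the product, by [dashv], of
    the word [m] and [f]. *)
Lemma ideal_shift m f : I f ->
  I (\sum_(a <- msupp f) << f@_a *g shift m a >>).
Proof.
move=> If; rewrite /shift; case: insubP => [m' _ _|_]; last by rewrite -monalgE.
have := @ideal_dashvl _ _ _ idealI << (inl m' : diword X) >> f If; congr I.
rewrite /dashv /= /di_dashv (bilin_extEw _ msuppU_le (fsubset_refl _)) big_seq_fset1.
by apply: eq_bigr => a _; congr << _ *g _ >>; rewrite mcoeffUU mul1r.
Qed.

Definition leads a f :=
  f@_a = 1 /\ forall b, b \in msupp f -> lexle (wcode b) (wcode a).

Definition leading a := exists2 f, I f & leads a f.

Lemma leading_exists f : I f -> f != 0 -> exists2 a, a \in msupp f & leading a.
Proof.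
move=> If nz.
have [|a af amax] := @max_exists _ (@wcode X) (msupp f).
  by apply: contraNneq nz => f0; rewrite (monalgE f) f0 big_nil.
exists a => //; exists ((f@_a)^-1 *: f); first exact: idealZ.
split=> [|b]; first by rewrite mcoeffZ mulVf // mcoeff_neq0.
by move/(fsubsetP (msuppZ_le _ _)); apply: amax.
Qed.

(** If [f] is monic with greatest word [a], then [a] is congruent to [tail a f]
    modulo any subspace that contains [f]. *)
Definition tail a f : seq (diword X * k) :=
  [seq (b, - f@_b) | b <- msupp f & b != a].

Definition term_code (t : diword X * k) : term k := (wcode t.1, t.2).

Definition rule_code (r : diword X * Di k X) : rule k :=
  (wcode r.1, [seq term_code t | t <- tail r.1 r.2]).

Lemma lexle_lt a b : lexle (wcode a) (wcode b) -> a != b -> wlt a b.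
Proof.
rewrite /wlt /lexlt /lexle le_eqVlt => /predU1P [/wcode_entry/entry_inj->|//].
by rewrite eqxx.
Qed.

(** The reduct [s] is [x * b] minus [x] times the multiple of [f] by [b / a],
    whose greatest word is [b]. *)
Lemma rewrite_term_sound a f b (x : k) :
  I f -> leads a f -> matches X (wcode a) (wcode b) ->
  exists s : seq (diword X * k),
    [/\ rewrite_term X (rule_code (a, f)) (wcode b, x) = [seq term_code t | t <- s],
        {in s, forall t, wlt t.1 b} & I (<< x *g b >> - lincomb s)].
Proof.
move=> If [fa fmax] ab; pose m := divcm (diword_val b) (diword_val a).
exists [seq (shift m t.1, t.2 * x) | t <- tail a f]; split.
- rewrite /rewrite_term /= -!map_comp; apply/eq_in_map => c /=.
  rewrite mem_filter => /andP [_ /fmax/index_lexle ca].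
  by rewrite /term_code /= translate_wcode.
- move=> _ /mapP [_ /mapP [c + ->] ->] /=; rewrite mem_filter => /andP [ca /fmax ac].
  by apply: wlt_shift => //; apply: lexle_lt.
have := idealZ idealI x (ideal_shift m If); congr I.
have af : a \in msupp f by rewrite -mcoeff_neq0 fa oner_eq0.
rewrite (bigD1_seq a af (fset_uniq _)) /= fa shift_quotient // scalerDr malgZU mulr1; congr (_ + _).
rewrite /lincomb !big_map big_filter -sumrN scaler_sumr.
by apply: eq_bigr => c _ /=; rewrite malgZU mulNr monalgUN opprK mulrC.
Qed.

(** * Finite bases and normal forms *)

Definition basis := seq (diword X * Di k X).

Definition normal (G : basis) a := ~~ has (fun r => matches X (wcode r.1) (wcode a)) G.

(** The coordinate [2 - diword_index a] added to [wcode a] makes words of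
    different indices incomparable, so that one use of Dickson's lemma treats both
    indices at once. *)
Lemma basis_exists : exists2 G : basis,
  {in G, forall r, I r.2 /\ leads r.1 r.2} & forall a, leading a -> ~~ normal G a.
Proof.
have [|B Blead Bdiv] := @dickson _ #|X|.+2 (fun a => (2 - diword_index a)%N :: wcode a) leading.
  by move=> a _; apply: (congr1 S (size_wcode a)).
have [G GI GB] : exists2 G : basis, {in G, forall r, I r.2 /\ leads r.1 r.2} & map fst G = B.
  elim: B Blead {Bdiv} => [|a B IHB] Blead; first by exists [::].
  have [b bB|G GI <-] := IHB; first by apply: Blead; rewrite inE bB orbT.
  have [f If fa] := Blead a (mem_head _ _).
  by exists ((a, f) :: G) => // r; rewrite inE => /predU1P [->|/GI].
exists G => // a /Bdiv [b]; rewrite -GB => /mapP [r rG ->].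
rewrite !wcodeE /= => /and3P [le2 le1 lev]; rewrite negbK; apply/hasP; exists r => //.
apply/matchesP; split=> [|x].
  by apply/eqP; rewrite eqn_leq le1 /=; case: (r.1) (a) le2 => ? [].
have : x \in enum X by rewrite mem_enum.
elim: (enum X) lev => //= y s IHs /andP [ley /IHs {}IHs].
by rewrite inE => /predU1P [->|/IHs].
Qed.

Lemma lincomb_coef s a : (lincomb s)@_a = \sum_(t <- s | t.1 == a) t.2.
Proof.
rewrite /lincomb raddf_sum [RHS]big_mkcond /=; apply: eq_bigr => t _.
by rewrite mcoeffU; case: eqP.
Qed.

Lemma lincomb_supp s a : a \in msupp (lincomb s) -> exists2 t, t \in s & t.1 = a.
Proof.
rewrite -mcoeff_neq0 lincomb_coef => nz; apply: NNPP => nex; case/eqP: nz.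
by rewrite big_seq_cond big1 // => t /andP [ts /eqP ta]; case: nex; exists t.
Qed.

Lemma lincomb_cat s1 s2 : lincomb (s1 ++ s2) = lincomb s1 + lincomb s2 :> Di k X.
Proof. exact: big_cat. Qed.

Lemma lincomb_cons t s : lincomb (t :: s) = << t.2 *g t.1 >> + lincomb s :> Di k X.
Proof. exact: big_cons. Qed.

(** The greatest word of a nonzero element of the ideal is leading, hence not
    normal. *)
Lemma normal_ideal_eq0 G s : (forall a, leading a -> ~~ normal G a) ->
  {in s, forall t, normal G t.1} -> I (lincomb s) -> lincomb s = 0.
Proof.
move=> lG ns Is; apply/eqP/negPn/negP => /(leading_exists Is) [a /lincomb_supp [t ts <-]].
by move=> /lG; rewrite ns.
Qed.

Definition terms_code (s : seq (diword X * k)) : seq (term k) := [seq term_code t | t <- s].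

Lemma coef_terms s a : coef X (terms_code s) (wcode a) = (lincomb s)@_a.
Proof.
have same b : same_word X (wcode b) (wcode a) = (b == a).
  apply/allP/eqP => [e|-> //]; apply: entry_inj => o.
  by have /eqP := e o (mem_coords o); rewrite !coord_wcode.
suff foldE x : foldl (fun y t => if same_word X t.1 (wcode a) then t.2 + y else y) x
    (terms_code s) = (lincomb s)@_a + x by rewrite /coef foldE addr0.
rewrite lincomb_coef; elim: s x => [|t s IHs] x /=; first by rewrite big_nil add0r.
by rewrite IHs same big_cons; case: eqP => // _; rewrite addrCA addrA.
Qed.

(** Every word in the support of a combination occurs in the list, so testing the
    coefficients of the listed words is enough. *)
Lemma vanishesP s : vanishes X (terms_code s) <-> lincomb s = 0.
Proof.
have -> : vanishes X (terms_code s) = all (fun t => (lincomb s)@_t.1 == 0) s.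
  rewrite /vanishes -[RHS]andTb; elim: {2 4}s true => [|t r IHr] b /=; first by rewrite andbT.
  by rewrite IHr coef_terms; case: eqP; rewrite ?andbF.
split=> [/allP s0|->]; last by apply/allP => t _; rewrite mcoeff0.
apply/malgP => a; rewrite mcoeff0.
have [/lincomb_supp [t ts <-]|/mcoeff_outdom //] := boolP (a \in msupp (lincomb s)).
exact/eqP/s0.
Qed.

Lemma step_normal G a (x : k) rest acc : normal G a ->
  step X (map rule_code G) ((wcode a, x) :: rest, acc) = (rest, (wcode a, x) :: acc).
Proof. by rewrite /step /normal; elim: G => //= r G IHG; rewrite negb_or => /andP [/negbTE -> /IHG]. Qed.

Lemma step_reducible G a : ~~ normal G a ->
  exists r, [/\ r \in G, matches X (wcode r.1) (wcode a) & forall (x : k) rest acc,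
    step X (map rule_code G) ((wcode a, x) :: rest, acc) =
      (rewrite_term X (rule_code r) (wcode a, x) ++ rest, acc)].
Proof.
rewrite /step /normal negbK; elim: G => //= r G IHG.
case ra: (matches X (wcode r.1) (wcode a)); first by exists r; rewrite mem_head.
case/IHG=> r' [r'G r'a stepE].
by exists r'; rewrite inE r'G orbT.
Qed.

(** * Correctness of the program *)

Section Loop.
Context (G : basis) (loop : prog k).
Hypothesis G_sound : {in G, forall r, I r.2 /\ leads r.1 r.2}.
Hypothesis loopP : forall (t : term k) (rest acc : seq (term k)) u,
  eval loop (code (step X (map rule_code G) (t :: rest, acc))) u ->
  eval loop (code (t :: rest, acc)) u.

(** The clause about runs says that from a worklist beginning with [s] the loop
    reaches the state where [s] is consumed and [r] set aside. It is stated on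
    the results [u] of the rest of the run, so that it composes. *)
Definition normalizes s (r : seq (diword X * k)) := [/\ {in r, forall t, normal G t.1},
  I (lincomb s - lincomb r) &
  forall (rest acc : seq (term k)) u, eval loop (code (rest, terms_code r ++ acc)) u ->
    eval loop (code (terms_code s ++ rest, acc)) u].

Lemma normalizes_terms s :
  {in s, forall t, exists r, normalizes [:: t] r} -> exists r, normalizes s r.
Proof.
elim: s => [|t s IHs] ns.
  by exists [::]; split=> //; rewrite subrr; apply: ideal0.
have [r2 [n2 I2 e2]] : exists r, normalizes s r.
  by apply: IHs => t' t's; apply: ns; rewrite inE t's orbT.
have [r1 [n1 I1 e1]] := ns t (mem_head _ _).
exists (r2 ++ r1); split=> [t'||rest acc u].
- by rewrite mem_cat => /orP [/n2|/n1].
- rewrite -cat1s !lincomb_cat [lincomb r2 + _]addrC opprD addrACA; exact: idealD.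
by rewrite /terms_code map_cat -catA => /e2 /e1.
Qed.

(** Well-founded induction on the word: rewriting replaces a term by terms with
    smaller words, which are pushed on the worklist and are processed before the
    rest of it. *)
Lemma normalizes_term t : exists r, normalizes [:: t] r.
Proof.
case: t => a x; elim/(well_founded_ind (@wlt_wf X)): a x => a IHa x.
have [na|ra] := boolP (normal G a).
  exists [:: (a, x)]; split=> [t|| rest acc u eu].
  - by rewrite inE => /eqP ->.
  - by rewrite subrr; apply: ideal0.
  by apply: loopP; rewrite step_normal.
have [[b f] [rG ba stepE]] := step_reducible ra.
have [/= If fb] := G_sound rG.
have [s [sE sa Is]] := rewrite_term_sound x If fb ba.
have [r [nr Ir er]] : exists r, normalizes s r.
  by apply: normalizes_terms => -[c y] /sa ca; apply: IHa ca _.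
exists r; split=> // [|rest acc u /er eu].
  by rewrite -(subrKA (lincomb s)) lincomb_cons /lincomb big_nil addr0; apply: idealD.
by apply: loopP; rewrite stepE sE.
Qed.
End Loop.

End Rewriting.

Theorem theorem34 (k : fieldType) (X : finType) (S : {fset Di k X}) :
  exists p : prog k,
    forall (f : Di k X) (s : seq (diword X * k)), lincomb s = f ->
      exists b : bool,
        eval p (enc_lincomb s) (enc_bool k b) /\ (b <-> Id (mem S) f).
Proof.
have idealI := Id_is_ideal (mem S).
have [G GI Glead] := basis_exists (Id (mem S)).
have [loop [loop_nil loopP]] := computable_while (computable_step X (map (@rule_code k X) G)).
have [test testP] := computable_vanishes k X.
exists (Seq (Pair Skip (Const Nil)) (Seq loop (Seq (Instr Tail) test))) => f s <-.
have [r [nr Isr er]] : exists r, normalizes (Id (mem S)) G loop s r.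
  by apply: normalizes_terms => // t _; apply: normalizes_term => // t' s' acc u; apply: loopP.
exists (vanishes X (terms_code r)); split.
  apply: (@eval_seq _ _ _ _ (code (terms_code s, [::] : seq (term k)))).
    have -> : enc_lincomb s = code (terms_code s).
      elim: s {Isr er} => // t s IHs; congr (Cons _ _) => //; congr Cons.
      by rewrite /= wcodeE.
    exact: (eval_pair (eval_skip _) (eval_const _ _)).
  apply: (@eval_seq _ _ _ _ (code ([::] : seq (term k), terms_code r))).
    by rewrite -[terms_code s]cats0; apply: er; rewrite cats0; apply: loop_nil.
  by apply: eval_seq (testP _); apply: eval_instr.
split=> [/vanishesP r0|Is].
  by apply/(ideal_congr idealI Isr); rewrite r0; apply: ideal0.
by apply/vanishesP; apply: (normal_ideal_eq0 idealI Glead nr); apply/(ideal_congr idealI Isr).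
Qed.
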